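(* Let $\mathscr{F}\subseteq\mathscr{P}(\omega)$ be a nonempty $\omega$-closed family with $\varnothing\notin\mathscr{F}$. Then the semigroup $\boldsymbol{B}_{\mathbb{Z}}^{\mathscr{F}}$ is simple if and only if for all $F_1,F_2\in\mathscr{F}$ there exist $k_1,k_2\in\omega$ such that $F_1\subseteq -k_1+F_2$ and $F_2\subseteq -k_2+F_1$.
   Context: $\omega$ is the set of non-negative integers and $\mathscr{P}(\omega)$ is the family of all its subsets. For $n\in\mathbb{Z}$ and $A\subseteq\mathbb{Z}$ put $n+A=\{n+a: a\in A\}$. A family $\mathscr{F}\subseteq\mathscr{P}(\omega)$ is $\omega$-closed if $F_1\cap(-n+F_2)\in\mathscr{F}$ for all $n\in\omega$ and $F_1,F_2\in\mathscr{F}$. For an $\omega$-closed family $\mathscr{F}$ with $\varnothing\notin\mathscr{F}$, $\boldsymbol{B}_{\mathbb{Z}}^{\mathscr{F}}$ is the set $\mathbb{Z}\times\mathbb{Z}\times\mathscr{F}$ with the associative operation $$(i_1,j_1,F_1)\cdot(i_2,j_2,F_2)=\begin{cases}(i_1-j_1+i_2,\;j_2,\;(j_1-i_2+F_1)\cap F_2), & j_1<i_2;\\ (i_1,\;j_2,\;F_1\cap F_2), & j_1=i_2;\\ (i_1,\;j_1-i_2+j_2,\;F_1\cap(i_2-j_1+F_2)), & j_1>i_2.\end{cases}$$ A semigroup $S$ is simple if it contains no proper two-sided ideals, i.e. $S$ consists of a single $\mathscr{J}$-class. *)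

(* Defs.v *)
From HB Require Import structures.
From mathcomp Require Import all_boot all_order all_algebra.
From mathcomp Require Import boolp classical_sets.
From mathcomp Require Import zify.

Set Implicit Arguments.
Unset Strict Implicit.
Unset Printing Implicit Defensive.

Import Order.TTheory GRing.Theory Num.Theory.

Local Open Scope classical_set_scope.
Local Open Scope ring_scope.

(* The non-negative integers, as a subset of Z: a family of subsets of omega is
   represented as a family of subsets of Z whose members lie below [omega], so
   that sets and their translates by negative integers live in the same type. *)
Definition omega : set int := range Posz.

Definition shift (n : int) (A : set int) : set int := [set n + a | a in A].

Definition omega_closed (F : set (set int)) : Prop :=
  forall (n : nat) (F1 F2 : set int),
    F F1 -> F F2 -> F (F1 `&` shift (- n%:Z) F2).

Definition bz_op (x y : int * int * set int) : int * int * set int :=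
  let: (i1, j1, F1) := x in
  let: (i2, j2, F2) := y in
  if j1 < i2 then (i1 - j1 + i2, j2, shift (j1 - i2) F1 `&` F2)
  else if j1 == i2 then (i1, j2, F1 `&` F2)
  else (i1, j1 - i2 + j2, F1 `&` shift (i2 - j1) F2).

Lemma shiftE (n : int) (A : set int) (x : int) : shift n A x = A (x - n).
Proof.
apply/propext; split=> [[a Aa <-]|Ax]; first by rewrite addrC addKr.
by exists (x - n) => //; rewrite addrC subrK.
Qed.

Lemma shift0 (A : set int) : shift 0 A = A.
Proof. by apply/funext => x; rewrite shiftE subr0. Qed.

Lemma shift_shift (m n : int) (A : set int) :
  shift m (shift n A) = shift (m + n) A.
Proof.
by apply/funext => x; rewrite !shiftE; congr (A _); rewrite opprD addrA.
Qed.

Lemma shiftI (n : int) (A B : set int) :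
  shift n (A `&` B) = shift n A `&` shift n B.
Proof. by apply/funext => x; rewrite /setI /mkset !shiftE. Qed.

Lemma bz_opE (i1 j1 i2 j2 : int) (F1 F2 : set int) :
  let m := Num.max j1 i2 in
  bz_op (i1, j1, F1) (i2, j2, F2) =
  (i1 - j1 + m, j2 - i2 + m, shift (j1 - m) F1 `&` shift (i2 - m) F2).
Proof.
rewrite /bz_op; case: ltgtP => [lt_ji|lt_ij|->] /=.
- by rewrite subrr shift0 subrK.
- by rewrite subrr shift0 subrK addrC addrA addrAC.
- by rewrite subrr shift0 shift0 !subrK.
Qed.

Lemma bz_opA : associative bz_op.
Proof.
move=> [[i1 j1] F1] [[i2 j2] F2] [[i3 j3] F3].
rewrite !bz_opE !shiftI !shift_shift -setIA.
congr (_, _, _ `&` (_ `&` _)); try lia; congr (shift _ _); lia.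
Qed.

Lemma bz_op_closed (F : set (set int)) (hF : omega_closed F)
    (x y : int * int * set int) :
  F x.2 -> F y.2 -> F (bz_op x y).2.
Proof.
have hS (d : int) (A B : set int) :
    d <= 0 -> F A -> F B -> F (A `&` shift d B).
  by move=> d0 FA FB; have := hF `|d|%N A B FA FB; rewrite abszE ler0_norm ?opprK.
move: x y => [[i1 j1] F1] [[i2 j2] F2] /= h1 h2.
case: ltgtP => [lt_ji|lt_ij|_] /=.
- by rewrite setIC; apply: hS => //; lia.
- by apply: hS => //; lia.
- by rewrite -(shift0 F2); apply: hS.
Qed.

(* The set Z x Z x F.  The proof of omega-closedness is a parameter of the type
   because the semigroup instance below depends on it. *)
Definition BZF (F : set (set int)) (hF : omega_closed F) : Type :=
  set_type ([set: int] `*` [set: int] `*` F).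

Section BZFSemigroup.
Variables (F : set (set int)) (hF : omega_closed F).

HB.instance Definition _ := Choice.on (BZF hF).

Lemma BZF_mul_subproof (x y : BZF hF) :
  bz_op (val x) (val y) \in [set: int] `*` [set: int] `*` F.
Proof.
have [_ hx] := set_valP x; have [_ hy] := set_valP y.
by apply/mem_set; split=> //=; apply: bz_op_closed.
Qed.

Definition BZF_mul (x y : BZF hF) : BZF hF :=
  SigSub (BZF_mul_subproof x y).

Lemma BZF_mulA : associative BZF_mul.
Proof. by move=> x y z; apply: val_inj; rewrite /= bz_opA. Qed.

HB.instance Definition _ := isSemigroup.Build (BZF hF) BZF_mulA.

End BZFSemigroup.

Definition two_sided_ideal (S : semigroupType) (I : set S) : Prop :=
  I !=set0 /\ forall s x : S, I x -> I (s * x)%g /\ I (x * s)%g.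

Definition simple_semigroup (S : semigroupType) : Prop :=
  forall I : set S, two_sided_ideal I -> I = [set: S].

(* Main.v *)
Require Import Defs.
From mathcomp Require Import all_boot all_order all_algebra.
From mathcomp Require Import boolp classical_sets.
From mathcomp Require Import zify.

Import Order.TTheory GRing.Theory.

Local Open Scope classical_set_scope.
Local Open Scope ring_scope.

(** Third coordinates of a product only shrink and move left, so for a fixed B
    the triples whose set lies in some -k + B with k >= 0 form an ideal;
    simplicity makes it everything.  Conversely, if A lies in -k + B then
    (a, b, A) = (a, i + k, A) (i, j, B) (j + k, b, A). *)

Lemma shiftS (n : int) (A B : set int) :
  A `<=` B -> shift n A `<=` shift n B.
Proof. exact: image_subset. Qed.

(** In the uniform formula [bz_opE] the two sets are shifted by [j1 - m] and [i2 - m], where [m] is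
    the maximum of the inner indices [j1] and [i2]; neither shift is positive. *)
Lemma bz_op_sub_shift (x y : int * int * set int) :
  exists k1 k2 : nat, (bz_op x y).2 `<=` shift (- k1%:Z) x.2
                   /\ (bz_op x y).2 `<=` shift (- k2%:Z) y.2.
Proof.
case: x y => [[i1 j1] A] [[i2 j2] B].
exists `|Num.max j1 i2 - j1|%N, `|Num.max j1 i2 - i2|%N.
rewrite bz_opE /=.
have -> : - `|Num.max j1 i2 - j1|%N%:Z = j1 - Num.max j1 i2 by lia.
have -> : - `|Num.max j1 i2 - i2|%N%:Z = i2 - Num.max j1 i2 by lia.
by split=> x [].
Qed.

(** The inner index [i + k] exceeds [i] by exactly [k], so the first product meets [A] with
    [shift (- k) B], which absorbs into [A] and leaves [(a, j + k, A)]. The last factor starts at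
    [j + k], so no further shift occurs. *)
Lemma bz_op_factor (a b i j : int) (k : nat) (A B : set int) :
  A `<=` shift (- k%:Z) B ->
  bz_op (bz_op (a, i + k%:Z, A) (i, j, B)) (j + k%:Z, b, A) = (a, b, A).
Proof.
move=> AB; rewrite (bz_opE a).
have -> : Num.max (i + k%:Z) i = i + k%:Z by lia.
have -> : i - (i + k%:Z) = - k%:Z by lia.
have -> : a - (i + k%:Z) + (i + k%:Z) = a by lia.
have -> : j - i + (i + k%:Z) = j + k%:Z by lia.
by rewrite subrr shift0 (setIidl AB) /bz_op ltxx eqxx setIid.
Qed.

Section BZFIdeals.
Context (F : set (set int)) (hcl : omega_closed F).

Lemma BZF_elem (i j : int) (A : set int) :
  F A -> exists x : BZF hcl, val x = (i, j, A).
Proof.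
move=> FA.
have h : (i, j, A) \in [set: int] `*` [set: int] `*` F by exact: mem_set.
by exists (SigSub h : BZF hcl).
Qed.

Lemma val_BZF_mul (x y : BZF hcl) : val (x * y)%g = bz_op (val x) (val y).
Proof. by []. Qed.

Lemma two_sided_ideal_sub_shift (B : set int) : F B ->
  two_sided_ideal
    [set x : BZF hcl | exists k : nat, (val x).2 `<=` shift (- k%:Z) B].
Proof.
move=> FB; split.
  have [x xE] := BZF_elem 0 0 B FB.
  by exists x, 0%N; rewrite xE oppr0 shift0.
move=> s x [k xB].
(* Successive left shifts add up, so left and right multiples are handled alike. *)
have shift_trans (C : set int) (l : nat) :
    C `<=` shift (- l%:Z) (val x).2 ->
    exists k' : nat, C `<=` shift (- k'%:Z) B.
  move=> Cx; exists (l + k)%N.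
  have -> : - (l + k)%N%:Z = - l%:Z + - k%:Z by lia.
  by rewrite -shift_shift; apply: subset_trans Cx (shiftS _ _ _ xB).
split; rewrite /mkset val_BZF_mul.
- by have [_ [l [_ /shift_trans]]] := bz_op_sub_shift (val s) (val x).
- by have [l [m [/shift_trans]]] := bz_op_sub_shift (val x) (val s).
Qed.

Lemma simple_sub_shift (A B : set int) :
  simple_semigroup (BZF hcl) -> F A -> F B ->
  exists k : nat, A `<=` shift (- k%:Z) B.
Proof.
move=> simpleF FA FB; have [x xE] := BZF_elem 0 0 A FA.
have IT := simpleF _ (two_sided_ideal_sub_shift B FB).
have : [set: BZF hcl] x by [].
(* Membership of [(0, 0, A)] in the ideal attached to [B] is the required inclusion. *)
by rewrite -IT /= xE.
Qed.

Lemma sub_shift_simple :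
  (forall A B : set int, F A -> F B ->
     exists k : nat, A `<=` shift (- k%:Z) B) ->
  simple_semigroup (BZF hcl).
Proof.
move=> subF I [[x Ix] idealI]; apply/seteqP; split=> // y _.
case xE : (val x) (set_valP x) => [[i j] B] [_ /= FB].
case yE : (val y) (set_valP y) => [[a b] A] [_ /= FA].
(* The set of the target [y] must embed in a left shift of the set of [x], since products only
   shrink. *)
have [k AB] := subF A B FA FB.
have [u uE] := BZF_elem a (i + k%:Z) A FA.
have [v vE] := BZF_elem (j + k%:Z) b A FA.
have -> : y = (u * x * v)%g.
  by apply: val_inj; rewrite !val_BZF_mul uE xE vE bz_op_factor.
exact: (idealI v _ (idealI u x Ix).1).2.
Qed.

End BZFIdeals.

Theorem mainTheorem6 (F : set (set int))
    (hsub : forall A : set int, F A -> A `<=` omega)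
    (hne : F !=set0)
    (hcl : omega_closed F)
    (h0 : ~ F set0) :
  simple_semigroup (BZF hcl) <->
  (forall F1 F2 : set int, F F1 -> F F2 ->
     exists k1 k2 : nat,
       F1 `<=` shift (- k1%:Z) F2 /\ F2 `<=` shift (- k2%:Z) F1).
Proof.
split=> [simpleF F1 F2 FF1 FF2|subF].
  (* The two inclusions come from two different ideals, those attached to [F2] and to [F1]. *)
  have [k1 h1] := simple_sub_shift _ _ _ _ simpleF FF1 FF2.
  have [k2 h2] := simple_sub_shift _ _ _ _ simpleF FF2 FF1.
  by exists k1, k2.
apply: sub_shift_simple => A B FA FB.
by have [k [_ [AB _]]] := subF A B FA FB; exists k.
Qed.
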